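(* Let $G$ be a finite group acting on a connected space $X$ such that $S=\operatorname{Sing}_G(X)=\bigcup_{g\in G\setminus\{e\}}X^g$ is finite. Then there is a $\Sigma_n[G]$-equivariant isomorphism of posets $\mathcal{P}_n(G,X)\cong\mathcal{D}_n(G,S)$.
   Context: ''Space'' means a CW complex or an algebraic variety over an algebraically closed field; $X^g$ is the fixed set of $g$, and $G$ acts on the finite set $S$. The arrangement $\mathcal{A}_n(G,X)$ in $X^n$ consists of the closed subspaces $H_{ij}(g)=\{(x_1,\dots,x_n): g.x_i=x_j\}$ for $1\leq i<j\leq n$, $g\in G$, and $H_i^s=\{(x_1,\dots,x_n):x_i=s\}$ for $1\leq i\leq n$, $s\in S$. A layer is a connected component of an intersection of a subfamily of $\mathcal{A}_n(G,X)$ (the empty intersection being $X^n$); $\mathcal{P}_n(G,X)$ is the set of layers ordered by reverse inclusion. $\Sigma_n[G]=G^n\rtimes\Sigma_n$ acts on $X^n$ by $(g_1,\dots,g_n,\sigma)$ sending $(x_1,\dots,x_n)$ to the tuple whose $\sigma(i)$-th entry is $g_i.x_i$; this permutes the arrangement and hence acts on $\mathcal{P}_n(G,X)$. Combinatorial side: a projectivized $G$-coloring of a finite set $B$ is an equivalence class of $b:B\to G$ with $b\sim bg$; a partial $G$-partition $\tilde\beta$ of $[n]$ is a partition $\beta$ of a subset of $[n]$ into nonempty blocks each with a projectivized $G$-coloring, with zero block $Z=[n]\setminus\bigcup B$; $\mathcal{D}_n(G,S)$ is the set of pairs $(\tilde\beta,z)$, $z:Z\to S$, ordered by the order generated by (merge)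 $(\tilde\beta\cup\{\tilde A,\tilde B\},z)\prec(\tilde\beta\cup\{\tilde C\},z)$ where $C=A\cup B$, $c=a\cup bg$ for some $g\in G$, and (color) $(\tilde\beta\cup\{\tilde B\},z)\prec(\tilde\beta,z')$ where $z'|_Z=z$, $z'|_B=f\circ b$ for a $G$-equivariant $f:G\to S$. $\Sigma_n[G]$ acts on $\mathcal{D}_n(G,S)$ by $(g_1,\dots,g_n,\sigma)$: blocks $\sigma(B)$ colored by $b'(\sigma(j))=g_jb(j)$, zero block $\sigma(Z)$ colored by $z'(\sigma(j))=g_j.z(j)$.
   Formalization: X is assumed to have at least two distinct points; for X a single point (e.g. G trivial, n = 2) P_n(G,X) has one element while D_n(G,S) has more, so the claim as stated fails there. *)

(* Defs.v *)
From HB Require Import structures.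
From mathcomp Require Import all_boot all_order all_algebra all_fingroup.
From mathcomp Require Import all_classical all_reals topology.
From mathcomp Require mpoly.
From Stdlib Require Import Relations.Relation_Operators.

Set Implicit Arguments.
Unset Strict Implicit.
Unset Printing Implicit Defensive.

Import GRing.Theory numFieldTopology.Exports.

Local Open Scope classical_set_scope.
Local Open Scope ring_scope.

(** * CW complexes *)

Section CW.
Variable R : realType.

(* The norm of the library on row vectors is the sup norm, hence the explicit
   Euclidean one; both induce the topology of ['rV[R]_d]. *)
Definition sqnorm d (v : 'rV[R]_d) : R := \sum_i v 0 i ^+ 2.
Definition disk d : set 'rV[R]_d := [set v | sqnorm v <= 1].
Definition open_disk d : set 'rV[R]_d := [set v | sqnorm v < 1].
Definition sphere d : set 'rV[R]_d := [set v | sqnorm v = 1].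
Arguments disk d : clear implicits.
Arguments open_disk d : clear implicits.
Arguments sphere d : clear implicits.

(* [char_map c] is only meaningful on the closed disk. The fields
   [cw_inj] and [cw_open] say that it restricts to a homeomorphism from the
   open disk onto its image. *)
Record cw_structure (X : topologicalType) := CWStructure {
  cell : Type;
  dim : cell -> nat;
  char_map : forall c, 'rV[R]_(dim c) -> X;
  open_cell := fun c => @char_map c @` open_disk (dim c);
  closed_cell := fun c => @char_map c @` disk (dim c);
  cw_hausdorff : hausdorff_space X;
  cw_cont : forall c, {within disk (dim c), continuous (@char_map c)};
  cw_inj : forall c, set_inj (open_disk (dim c)) (@char_map c);
  cw_open : forall c (U : set 'rV[R]_(dim c)), open U ->
    exists2 V : set X, open V &
      @char_map c @` (U `&` open_disk (dim c)) = V `&` open_cell c;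
  cw_cover : \bigcup_c open_cell c = setT;
  cw_disjoint : trivIset setT open_cell;
  cw_closure_finite : forall c, exists F : set cell,
    [/\ finite_set F, (forall c', F c' -> (dim c' < dim c)%N) &
        @char_map c @` sphere (dim c) `<=` \bigcup_(c' in F) open_cell c'];
  cw_weak : forall A : set X,
    (forall c, closed (A `&` closed_cell c)) -> closed A
}.

End CW.

(** * Algebraic varieties over an algebraically closed field

    These are the classical varieties (topological space of closed points with
    its sheaf of regular functions), following Kempf, "Algebraic varieties":
    spaces with functions that are separated and covered by finitely many open
    affine varieties. They need not be irreducible. *)

Section Varieties.
Variable k : closedFieldType.

(* [regular U f] means that the restriction of f to the open set U is a regular
   function on U; the values of f outside of U are irrelevant. *)
Record functions_on (X : topologicalType) := FunctionsOn {
  regular :> set X -> set (X -> k);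
  regular_eq : forall U f g, open U -> {in U, f =1 g} ->
    regular U f -> regular U g;
  regular_cst : forall U a, open U -> regular U (fun=> a);
  regularD : forall U f g, open U -> regular U f -> regular U g ->
    regular U (fun x => f x + g x);
  regularM : forall U f g, open U -> regular U f -> regular U g ->
    regular U (fun x => f x * g x);
  regular_res : forall U V f, open U -> open V -> V `<=` U ->
    regular U f -> regular V f;
  regular_glue : forall U f, open U ->
    (forall x, U x -> exists V, [/\ open V, V x, V `<=` U & regular V f]) ->
    regular U f;
  open_nonvanishing : forall U f, open U -> regular U f ->
    open (U `&` [set x | f x != 0]);
  regularV : forall U f, open U -> regular U f ->
    regular (U `&` [set x | f x != 0]) (fun x => (f x)^-1)
}.

Definition zero_locus m (P : set (mpoly.mpoly m k)) : set ('I_m -> k) :=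
  [set v | forall p, P p -> mpoly.meval v p = 0].

(* U, with the induced topology and regular functions, is isomorphic to a
   Zariski closed subset of k^m with its regular functions (those that are
   locally quotients of polynomials). *)
Definition affine_open (X : topologicalType) (O : functions_on X) (U : set X) :=
  open U /\
  exists (m : nat) (P : set (mpoly.mpoly m k)) (phi : X -> 'I_m -> k),
    [/\ set_bij U (zero_locus P) phi,
        forall V, V `<=` U ->
          (open V <-> exists Q, V = U `&` phi @^-1` (~` zero_locus Q)) &
        forall V f, open V -> V `<=` U ->
          (O V f <->
           forall x, V x -> exists p q : mpoly.mpoly m k,
             mpoly.meval (phi x) q != 0 /\
             forall y, V y -> mpoly.meval (phi y) q != 0 ->
               f y = mpoly.meval (phi y) p / mpoly.meval (phi y) q)].

(* The n-fold power of X in the category of spaces with functions. Its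
   topology is not the product topology: it is generated by the nonvanishing
   loci of the functions sum_j prod_i f_ji(x_i) on U_1 x ... x U_n, with f_ji
   regular on the open set U_i. *)
Definition zariski_power (X : topologicalType) (O : functions_on X) (n : nat)
  : Type := 'I_n -> X.

Definition zariski_basic (X : topologicalType) (O : functions_on X) (n : nat)
    : set (set (zariski_power O n)) :=
  [set W | exists (U : 'I_n -> set X) (m : nat) (f : 'I_m -> 'I_n -> X -> k),
    [/\ forall i, open (U i),
        forall j i, O (U i) (f j i) &
        W = [set x | (forall i, U i (x i)) /\
                     \sum_j \prod_i f j i (x i) != 0]]].

HB.instance Definition _ (X : topologicalType) (O : functions_on X) n :=
  gen_eqMixin (zariski_power O n).
HB.instance Definition _ (X : topologicalType) (O : functions_on X) n :=
  gen_choiceMixin (zariski_power O n).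
HB.instance Definition _ (X : topologicalType) (O : functions_on X) n :=
  isSubBaseTopological.Build (zariski_power O n)
    (@zariski_basic X O n) (@id (set (zariski_power O n))).

Record variety_structure (X : topologicalType) := VarietyStructure {
  functions :> functions_on X;
  finite_affine_cover : exists (N : nat) (U : 'I_N -> set X),
    (forall a, affine_open functions (U a)) /\ \bigcup_a U a = setT;
  separated :
    closed [set x : zariski_power functions 2 | x ord0 = x ord_max]
}.

Definition variety_morphism (X : topologicalType) (O : functions_on X)
    (f : X -> X) :=
  continuous f /\
  forall U h, open U -> O U h -> O (f @^-1` U) (h \o f).

End Varieties.

(** * Spaces, their powers and group actions *)

Variant spaceType :=
  | CWComplex (R : realType) (X : topologicalType) (_ : cw_structure R X)
  | AlgVariety (k : closedFieldType) (X : topologicalType)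
               (_ : variety_structure k X).

Definition points (X : spaceType) : topologicalType :=
  match X with CWComplex _ T _ => T | AlgVariety _ T _ => T end.
Coercion points : spaceType >-> topologicalType.

Definition power_class (X : spaceType) (n : nat) : Topological ('I_n -> X) :=
  match X return Topological ('I_n -> X) with
  | CWComplex _ T _ => Topological.class (prod_topology (fun _ : 'I_n => T))
  | AlgVariety _ _ V => Topological.class (zariski_power V n)
  end.

(* The points of X^n are the functions ['I_n -> X]; it carries the product
   topology if X is a CW complex, and the Zariski topology if X is a variety. *)
Definition power (X : spaceType) (n : nat) : topologicalType :=
  @Topological.Pack ('I_n -> X) (power_class X n).

Definition endomorphism (X : spaceType) : (X -> X) -> Prop :=
  match X return (X -> X) -> Prop with
  | CWComplex _ T _ => fun f : T -> T => continuous f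
  | AlgVariety _ _ V => fun f => variety_morphism V f
  end.

(* Left actions; those of the library are right actions. *)
Definition is_left_action (G : finGroupType) (X : spaceType) (act : G -> X -> X) :=
  [/\ forall x, act 1%g x = x,
      forall g h x, act (g * h)%g x = act g (act h x) &
      forall g, endomorphism (act g)].

Section Posets.
Variables (G : finGroupType) (n : nat).

(* An element (g, s) of the wreath product G^n x| S_n; only the actions of the
   individual elements are needed to speak of equivariance. *)
Definition wreath := ({ffun 'I_n -> G} * 'S_n)%type.

(* A G-coloring b : B -> G of a subset B of [n]: [b i = None] off B. *)
Definition coloring := {ffun 'I_n -> option G}.

Definition color_support (b : coloring) : {set 'I_n} := [set i | b i != None]%SET.

Definition coloring_mulr (b : coloring) (g : G) : coloring :=
  [ffun i => omap (fun x => x * g)%g (b i)].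

(* a \cup b, for a and b with disjoint supports *)
Definition coloring_union (a b : coloring) : coloring :=
  [ffun i => if a i is Some x then Some x else b i].

(* the class of b under b ~ bg, i.e. a projectivized G-coloring *)
Definition proj_class (b : coloring) : {set coloring} :=
  [set coloring_mulr b g | g in [set: G]]%SET.

Definition wreath_coloring (w : wreath) (b : coloring) : coloring :=
  [ffun i => omap (fun x => w.1 ((w.2^-1)%g i) * x)%g (b ((w.2^-1)%g i))].

Definition block_support (C : {set coloring}) : {set 'I_n} :=
  (\bigcup_(b in C) color_support b)%SET.

Definition zero_block (beta : {set {set coloring}}) : {set 'I_n} :=
  (~: \bigcup_(C in beta) block_support C)%SET.

Definition is_partial_G_partition (beta : {set {set coloring}}) :=
  (forall C, C \in beta ->
    exists2 b, C = proj_class b & color_support b != finset.set0) /\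
  (forall C C', C \in beta -> C' \in beta -> C != C' ->
    [disjoint block_support C & block_support C']%bool).

Variables (X : spaceType) (act : G -> X -> X).

Definition Sing : set X := [set x | exists2 g : G, g != 1%g & act g x = x].

Definition wreath_power (w : wreath) (x : power X n) : power X n :=
  fun i => act (w.1 ((w.2^-1)%g i)) (x ((w.2^-1)%g i)).

(* A candidate for an element of D_n(G,S); [zcol i = None] off the zero block. *)
Record colored_partition := ColoredPartition {
  blocks : {set {set coloring}};
  zcol : 'I_n -> option X
}.

Definition wreath_partition (w : wreath) (d : colored_partition) :=
  ColoredPartition
    [set [set wreath_coloring w b | b in (C : {set coloring})]%SET
      | C in blocks d]%SET
    (fun i => omap (act (w.1 ((w.2^-1)%g i))) (zcol d ((w.2^-1)%g i))).

Variable S : set X.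

Definition arr_pair (i j : 'I_n) (g : G) : set (power X n) :=
  [set x | act g (x i) = x j].

Definition arr_point (i : 'I_n) (s : X) : set (power X n) := [set x | x i = s].

Definition arrangement : set (set (power X n)) :=
  [set H | (exists (i j : 'I_n) g, (i < j)%N /\ H = arr_pair i j g) \/
           (exists i s, S s /\ H = arr_point i s)].

(* The poset P_n(G,X) of layers, ordered by reverse inclusion. *)
Definition layers : set (set (power X n)) :=
  [set L | exists F x, [/\ F `<=` arrangement, (\bigcap_(H in F) H) x &
                           L = connected_component (\bigcap_(H in F) H) x]].

Definition layer_le (L M : set (power X n)) := M `<=` L.

Definition dowling : set colored_partition :=
  [set d | [/\ is_partial_G_partition (blocks d),
               forall i, i \in zero_block (blocks d) ->
                 exists2 s, S s & zcol d i = Some s &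
               forall i, i \notin zero_block (blocks d) -> zcol d i = None]].

Definition merge_step (d d' : colored_partition) :=
  exists (beta : {set {set coloring}}) (a b : coloring) (g : G),
    [/\ [disjoint color_support a & color_support b]%bool,
        blocks d = (beta :|: [set proj_class a; proj_class b])%SET,
        blocks d' =
          (beta :|: [set proj_class (coloring_union a (coloring_mulr b g))])%SET &
        zcol d' = zcol d].

Definition color_step (d d' : colored_partition) :=
  exists (b : coloring) (f : G -> X),
    [/\ forall g, S (f g),
        forall g h, f (g * h)%g = act g (f h),
        blocks d = (blocks d' :|: [set proj_class b])%SET &
        forall i, zcol d' i = if b i is Some x then Some (f x) else zcol d i].

Definition dowling_step (d d' : colored_partition) :=
  [/\ dowling d, dowling d' & merge_step d d' \/ color_step d d'].

Definition dowling_le := clos_refl_trans colored_partition dowling_step.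

End Posets.

Arguments layers {G} n {X} act S.
Arguments dowling {G} n {X} S.
Arguments dowling_le {G n X} act S.

(* Main.v *)
Require Import Defs.
From mathcomp Require Import all_boot all_algebra all_fingroup all_classical topology.
From mathcomp Require mpoly.
From Stdlib Require Import Relations.Relation_Operators.

(* A pair d = (beta, z) is sent to the flat of all x with x_i = z(i) on the zero
   block and x_j = b(j) b(i)^-1 x_i for i, j in a block coloured by b. A flat is
   connected: two of its points are joined by moving one block at a time, along
   the continuous image t |-> (b(i) t)_i of the connected space X. Conversely, in
   an intersection I of members of the arrangement let Z be the set of i such
   that x_i is singular for all x in I. As S is finite and points are closed, the
   coordinates in Z are constant on a component of I; outside Z the relations
   g x_i = x_j valid on I have a unique g, hence colour the blocks of a
   partition, and the component is the corresponding flat. For the order, if the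
   flat of d' is strictly contained in that of d, then an equation of d' that
   fails on the flat of d either fixes a coordinate, which gives a coloring step
   from d, or relates two distinct blocks, which gives a merge step; one concludes
   by induction on the number of blocks. *)

Set Implicit Arguments.
Unset Strict Implicit.
Unset Printing Implicit Defensive.
Import GRing.Theory.
Import (canonicals) mpoly.

Local Open Scope classical_set_scope.

(** * Topology of powers *)

Section ZariskiPower.
Local Open Scope ring_scope.
Variables (k : closedFieldType) (X : topologicalType).

Lemma regular_sum (O : functions_on k X) (U : set X) (m : nat)
    (f : 'I_m -> X -> k) :
  open U -> (forall j, O U (f j)) -> O U (fun x => \sum_j f j x).
Proof.
move=> oU Of; elim: m f Of => [|m IHm] f Of.
  apply: (@regular_eq _ _ O U (fun=> 0)) => //; last exact: regular_cst.
  by move=> x _; rewrite big_ord0.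
apply: (@regular_eq _ _ O U (fun x => f ord0 x + \sum_j f (lift ord0 j) x)) => //.
  by move=> x _; rewrite big_ord_recl.
by apply: regularD => //; apply: IHm.
Qed.

Lemma regular_prod (O : functions_on k X) (U : set X) (m : nat)
    (f : 'I_m -> X -> k) :
  open U -> (forall j, O U (f j)) -> O U (fun x => \prod_j f j x).
Proof.
move=> oU Of; elim: m f Of => [|m IHm] f Of.
  apply: (@regular_eq _ _ O U (fun=> 1)) => //; last exact: regular_cst.
  by move=> x _; rewrite big_ord0.
apply: (@regular_eq _ _ O U (fun x => f ord0 x * \prod_j f (lift ord0 j) x)) => //.
  by move=> x _; rewrite big_ord_recl.
by apply: regularM => //; apply: IHm.
Qed.

Lemma open_bigcap_ord (T : topologicalType) (n : nat) (U : 'I_n -> set T) :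
  (forall i, open (U i)) -> open [set x | forall i, U i x].
Proof.
move=> oU; rewrite openE => x Ux; apply: filter_forall => i.
by apply: open_nbhs_nbhs; split; [exact: oU|exact: Ux].
Qed.

(** Open sets of the power are unions of finite intersections of basic ones, so preimages of basic
    sets decide continuity. *)
Lemma continuous_to_zariski (O : functions_on k X) (T : topologicalType)
    (n : nat) (f : T -> zariski_power O n) :
  (forall W, zariski_basic W -> open (f @^-1` W)) -> continuous f.
Proof.
move=> of_basic; apply/continuousP => _ [P Pfin <-].
rewrite preimage_bigcup; apply: bigcup_open => V /Pfin[Q Qbasic <-].
rewrite preimage_bigcap openE => x Qx; apply: filter_bigI => W WQ.
apply: open_nbhs_nbhs; split; last exact: Qx.
by apply: of_basic; have := Qbasic _ WQ; rewrite inE.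
Qed.

Lemma variety_morphism_cst (O : functions_on k X) (c : X) :
  variety_morphism O (fun=> c).
Proof.
split=> [|U h oU _]; first exact: cst_continuous.
by apply: regular_cst; move/continuousP: (@cst_continuous X X c); apply.
Qed.

(** The preimage of a basic open set is the nonvanishing locus, on the open set [D], of a sum of
    products of pulled-back regular functions, which is itself regular. *)
Lemma zariski_tuple_continuous (O : functions_on k X) (n : nat)
    (h : 'I_n -> X -> X) :
  (forall i, variety_morphism O (h i)) ->
  continuous (fun t => (fun i => h i t) : zariski_power O n).
Proof.
move=> hO; apply: continuous_to_zariski => W [U [m [f [oU Of ->]]]].
have oV i : open (h i @^-1` U i).
  by have [/continuousP hc _] := hO i; exact: hc.
set D := [set t | forall i, U i (h i t)].
have oD : open D := open_bigcap_ord oV.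
have reg : O D (fun t => \sum_j \prod_i f j i (h i t)).
  apply: regular_sum => // j; apply: regular_prod => // i.
  apply: (@regular_res _ _ O (h i @^-1` U i)) => //; first by move=> t; apply.
  by have [_] := hO i; apply.
exact: open_nonvanishing oD reg.
Qed.

Lemma zariski_proj_continuous (O : functions_on k X) (n : nat) (i : 'I_n) :
  continuous (fun x : zariski_power O n => x i).
Proof.
apply/continuousP => V oV; pose U j := if j == i then V else setT.
have oU j : open (U j) by rewrite /U; case: ifP => _ //; exact: openT.
set W := _ @^-1` V; suff Wbasic : zariski_basic (W : set (zariski_power O n)).
  exists [set W]; last by rewrite bigcup_set1.
  by move=> _ ->; exact: (finI_from1 id Wbasic).
(* The only summand is a product of ones, so the basic set is the whole box with sides [U]. *)
exists U, 1%N, (fun _ _ _ => 1); split=> //.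
  by move=> _ j; exact: regular_cst.
apply/seteqP; split=> x /=; rewrite big_ord1 big1 // oner_neq0.
  move=> Vx; split=> // j; rewrite /U; case: eqP => // ->; exact: Vx.
by move=> [/(_ i)]; rewrite /U eqxx.
Qed.

(** Either an affine chart around [x] misses [y], or some chart coordinate differs at the two
    points; subtracting its value at [y] gives a polynomial that vanishes at [y] but not at [x]. *)
Lemma variety_accessible (V : variety_structure k X) : accessible_space X.
Proof.
move=> x y /eqP xy; have [N [U [affU Ucover]]] := finite_affine_cover V.
have : (\bigcup_a U a) x by rewrite Ucover.
case=> a _ Ux; have [oU [m [P [phi [[_ phi_inj _] phi_open _]]]]] := affU a.
have [Uy|nUy] := pselect (U a y); last first.
  by exists (U a); split => //; rewrite inE.
have [i phii] : exists i, phi x i <> phi y i.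
  apply/existsNP => phixy; apply: xy; apply: phi_inj; rewrite ?inE //.
  exact/funext.
pose q := (mpoly.mpolyX k (mpoly.mnm1 i) - mpoly.mpolyC m (phi y i))%R.
have evalq v : mpoly.meval v q = v i - phi y i.
  by rewrite mpoly.mevalB mpoly.mevalXU mpoly.mevalC.
exists (U a `&` phi @^-1` (~` zero_locus [set q])); split.
- by apply/phi_open; [move=> ? []|exists [set q]].
- rewrite inE; split=> // /(_ q erefl); rewrite evalq => /eqP.
  by rewrite subr_eq0 => /eqP.
- by rewrite inE => -[_]; apply => _ ->; rewrite evalq subrr.
Qed.

End ZariskiPower.

(** * Common properties of CW complexes and varieties *)

Lemma points_accessible (X : spaceType) : accessible_space X.
Proof.
case: X => [R X C|k X V] /=; last exact: variety_accessible V.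
exact: hausdorff_accessible (cw_hausdorff C).
Qed.

Lemma endomorphism_cst (X : spaceType) (c : X) :
  @endomorphism X (fun=> c).
Proof.
case: X c => [R X C|k X V] c /=; last exact: variety_morphism_cst.
exact: cst_continuous.
Qed.

Lemma power_tuple_continuous (X : spaceType) (n : nat) (h : 'I_n -> X -> X) :
  (forall i, endomorphism (h i)) ->
  continuous (fun t : X => (fun i => h i t) : power X n).
Proof.
case: X h => [R X C|k X V] h /= hE; last exact: zariski_tuple_continuous.
move=> t; apply/cvg_sup => i A [_ [[B oB <-] Bt] sBA].
apply: filterS sBA _; apply: (hE i t); exact: open_nbhs_nbhs.
Qed.

Lemma power_proj_continuous (X : spaceType) (n : nat) (i : 'I_n) :
  continuous (fun x : power X n => x i).
Proof.
case: X => [R X C|k X V] /=; last exact: zariski_proj_continuous.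
exact: (@proj_continuous _ (fun=> X)).
Qed.

(** Finite sets are closed in such a space, so [[set x]] is both open and closed in [A]. *)
Lemma connected_finite_subsingleton (T : topologicalType) (A B : set T) x y :
  accessible_space T -> finite_set B -> A `<=` B -> connected A ->
  A x -> A y -> x = y.
Proof.
move=> T1 finB AB cA Ax Ay; have finclosed := iffLR accessible_finite_set_closed T1.
have : A `&` [set x] = A.
  apply: cA; first by exists x.
    exists (~` (B `\ x)); first by rewrite openC; apply: finclosed; exact: finite_setD.
    apply/seteqP; split=> z [Az] => [->|nBz]; split=> //; first by move=> [_]; apply.
    by apply: contrapT => zx; apply: nBz; split; first exact: AB.
  by exists [set x] => //; apply: finclosed.
by move=> E; have [] : (A `&` [set x]) y by rewrite E.
Qed.

(** * Partitions and colorings *)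

Section Colorings.
Local Open Scope group_scope.
Variables (G : finGroupType) (n : nat).
Implicit Types (a b c : coloring G n) (g h : G) (i j : 'I_n).

Lemma coloring_mulrE b g i : coloring_mulr b g i = omap (mulg^~ g) (b i).
Proof. by rewrite ffunE. Qed.

Lemma coloring_mulr1 b : coloring_mulr b 1 = b.
Proof. by apply/ffunP => i; rewrite ffunE; case: (b i) => //= x; rewrite mulg1. Qed.

Lemma coloring_mulrM b g h :
  coloring_mulr (coloring_mulr b g) h = coloring_mulr b (g * h).
Proof. by apply/ffunP => i; rewrite !ffunE; case: (b i) => //= x; rewrite mulgA. Qed.

Lemma proj_classP b c :
  reflect (exists g, c = coloring_mulr b g) (c \in proj_class b).
Proof.
apply: (iffP imsetP) => [[g _ ->]|[g ->]]; first by exists g.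
by exists g; rewrite ?inE.
Qed.

Lemma mem_proj_class b : b \in proj_class b.
Proof. by apply/proj_classP; exists 1; rewrite coloring_mulr1. Qed.

Lemma proj_class_mulr b g : proj_class (coloring_mulr b g) = proj_class b.
Proof.
apply/setP => c; apply/proj_classP/proj_classP => -[h ->].
  by exists (g * h); rewrite coloring_mulrM.
by exists (g^-1 * h); rewrite coloring_mulrM mulKVg.
Qed.

Lemma proj_class_eqP b c :
  proj_class b = proj_class c <-> exists g, c = coloring_mulr b g.
Proof.
split=> [bc|[g ->]]; last by rewrite proj_class_mulr.
by apply/proj_classP; rewrite bc mem_proj_class.
Qed.

Lemma mem_color_support b i : (i \in color_support b) = (b i != None).
Proof. by rewrite inE. Qed.

Lemma color_support_mulr b g :
  color_support (coloring_mulr b g) = color_support b.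
Proof. by apply/setP => i; rewrite !inE ffunE; case: (b i). Qed.

Lemma block_support_proj_class b : block_support (proj_class b) = color_support b.
Proof.
apply/setP => i; apply/bigcupP/idP => [[c /proj_classP[g ->]]|bi].
  by rewrite color_support_mulr.
by exists b => //; apply: mem_proj_class.
Qed.

Lemma coloring_unionE a b i :
  coloring_union a b i = if a i is Some x then Some x else b i.
Proof. by rewrite ffunE. Qed.

End Colorings.

(** * Partial G-partitions and their links *)

Section Partitions.
Local Open Scope group_scope.
Variables (G : finGroupType) (n : nat).
Implicit Types (beta : {set {set coloring G n}}) (a b c : coloring G n).
Implicit Types (g h : G) (i j k : 'I_n).

(* The isomorphism sends the partition [beta] to the conditions [g x_i = x_j]
   for all [link beta i j g]; on a valid [beta] this is a groupoid. *)
Definition link beta i j g :=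
  exists b, [/\ proj_class b \in beta, b i = Some 1 & b j = Some g].

(** Dividing by the colour at [i] gives the representative with value 1 there that [link] asks for;
    the quotient of two colours does not depend on the representative. *)
Lemma link_coloring beta b i j g h :
  proj_class b \in beta -> b i = Some g -> b j = Some h ->
  link beta i j (h * g^-1).
Proof.
move=> bB bi bj; exists (coloring_mulr b g^-1).
by rewrite proj_class_mulr !coloring_mulrE bi bj /= mulgV.
Qed.

Lemma link_sym beta i j g : link beta i j g -> link beta j i g^-1.
Proof. by move=> [b [bB bi bj]]; rewrite -(mul1g g^-1); exact: link_coloring bB bj bi. Qed.

Lemma link_refl beta i j g : link beta i j g -> link beta i i 1.
Proof. by move=> [b [bB bi bj]]; exists b. Qed.

Section Valid.
Variable beta : {set {set coloring G n}}.
Hypothesis betaP : is_partial_G_partition beta.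

Lemma partition_classP (C : {set coloring G n}) : C \in beta ->
  exists b i, [/\ C = proj_class b, proj_class b \in beta & b i = Some 1].
Proof.
move=> CB; have [b Cb /set0Pn[i]] := betaP.1 C CB; rewrite inE.
case bi: (b i) => [g|//] _; exists (coloring_mulr b g^-1), i.
by rewrite proj_class_mulr -Cb coloring_mulrE bi /= mulgV.
Qed.

Lemma partition_same_class b c i :
  proj_class b \in beta -> proj_class c \in beta ->
  b i != None -> c i != None -> proj_class b = proj_class c.
Proof.
move=> bB cB bi ci; apply/eqP; apply: contraT => bc.
have := betaP.2 _ _ bB cB bc; rewrite !block_support_proj_class.
by move/pred0P => /(_ i); rewrite /= !inE bi ci.
Qed.

Lemma partition_coloring_eq b c i g h :
  proj_class b \in beta -> proj_class c \in beta ->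
  b i = Some g -> c i = Some h -> c = coloring_mulr b (g^-1 * h).
Proof.
move=> bB cB bi ci; have : proj_class b = proj_class c.
  by apply: (@partition_same_class _ _ i); rewrite ?bi ?ci.
move/proj_class_eqP => [u cE]; move: ci; rewrite cE coloring_mulrE bi /=.
by move=> [<-]; rewrite mulKg.
Qed.

Lemma zero_blockPn i : i \notin zero_block beta <-> link beta i i 1.
Proof.
rewrite inE negbK; split=> [/bigcupP[C CB]|[b [bB bi _]]].
  have [b Cb _] := betaP.1 C CB; move: CB; rewrite Cb => bB.
  rewrite block_support_proj_class mem_color_support.
  case bi: (b i) => [g|//] _.
  by rewrite -(mulgV g); exact: (link_coloring bB bi bi).
apply/bigcupP; exists (proj_class b) => //.
by rewrite block_support_proj_class inE bi.
Qed.

Lemma zero_block_coloring b i g :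
  proj_class b \in beta -> b i = Some g -> i \notin zero_block beta.
Proof.
by move=> bB bi; apply/zero_blockPn; rewrite -(mulgV g); exact: (link_coloring bB bi bi).
Qed.

Lemma link_src i j g : link beta i j g -> i \notin zero_block beta.
Proof. by move/link_refl => ?; apply/zero_blockPn. Qed.

Lemma link_dst i j g : link beta i j g -> j \notin zero_block beta.
Proof. by move/link_sym; exact: link_src. Qed.

(** The representative with value 1 at [i] is unique, so it is the graph of the links out of [i]. *)
Lemma link_reprP b i j g :
  proj_class b \in beta -> b i = Some 1 -> link beta i j g <-> b j = Some g.
Proof.
move=> bB bi; split=> [[c [cB ci cj]]|bj]; last by exists b.
by rewrite (partition_coloring_eq cB bB ci bi) mulg1 coloring_mulrE cj /= invg1 mulg1.
Qed.

Lemma link_fun i j g h : link beta i j g -> link beta i j h -> g = h.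
Proof.
move=> [b [bB bi bj]] /(link_reprP _ _ bB bi).
by rewrite bj => -[].
Qed.

End Valid.

(** Each block has a representative normalised at one of its points [i]; its value at [j] is the
    only [g] linking [i] to [j], so the links determine the blocks. *)
Lemma eq_partition_link beta beta' :
  is_partial_G_partition beta -> is_partial_G_partition beta' ->
  (forall i j g, link beta i j g <-> link beta' i j g) -> beta = beta'.
Proof.
wlog suff sub_case : beta beta' / is_partial_G_partition beta ->
    is_partial_G_partition beta' ->
    (forall i j g, link beta i j g <-> link beta' i j g) ->
    forall C, C \in beta -> C \in beta'.
  move=> P P' bb'; apply/setP => C; apply/idP/idP; apply: sub_case => // i j g.
  by split=> /bb'.
move=> P P' bb' C CB; have [b [i [-> bB bi]]] := partition_classP P CB.
have /bb' [b' [bB' bi' _]] : link beta i i 1 by exists b.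
suff -> : b = b' by [].
apply/ffunP => j; case bj: (b j) => [g|].
  by apply/esym/(link_reprP P' _ _ bB' bi')/bb'; exists b.
case bj': (b' j) => [g|//]; have /bb' : link beta' i j g by exists b'.
by move/(link_reprP P _ _ bB bi); rewrite bj.
Qed.

End Partitions.

(** * Flats and layers *)

Section Flats.
Local Open Scope group_scope.
Variables (G : finGroupType) (X : spaceType) (act : G -> X -> X) (n : nat).
Hypothesis act_ok : is_left_action act.
Hypothesis X_connected : connected [set: X].
Hypothesis X_not_point : exists x y : X, x <> y.
Hypothesis S_finite : finite_set (Sing act).
Implicit Types (d : colored_partition G n X) (x y : power X n).
Implicit Types (g h : G) (i j k : 'I_n) (s t p : X).

Local Notation S := (Sing act).
Local Notation dowling_poset := (dowling n S).

(** * The action and its singular points *)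

Lemma act1 p : act 1 p = p. Proof. by have [] := act_ok. Qed.
Lemma actM g h p : act (g * h) p = act g (act h p).
Proof. by have [] := act_ok. Qed.
Lemma actK g p : act g^-1 (act g p) = p. Proof. by rewrite -actM mulVg act1. Qed.
Lemma actKV g p : act g (act g^-1 p) = p. Proof. by rewrite -actM mulgV act1. Qed.

(** Conjugation by [g] carries the stabiliser of [p] to that of [act g p]. *)
Lemma Sing_act g p : S p -> S (act g p).
Proof.
move=> [h h1 hp]; exists (g * h * g^-1); last by rewrite -!actM mulgKV actM hp.
by apply: contraNneq h1 => E; rewrite -(mulKg g h) -(mulgKV g (g * h)) E mul1g mulVg.
Qed.

Lemma act_free g h p : ~ S p -> act g p = act h p -> g = h.
Proof.
move=> nSp ghp; apply/eqP; apply: contra_notT nSp => gh; exists (h^-1 * g).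
  by apply: contra_neq gh => E; rewrite -(mulKVg h g) E mulg1.
by rewrite actM ghp actK.
Qed.

(** Otherwise [X] would be a finite connected space with closed points, hence a single point. *)
Lemma nonsingular_point : exists p, ~ S p.
Proof.
apply/existsNP => SX; have [p [q pq]] := X_not_point; apply: pq.
exact: (connected_finite_subsingleton (@points_accessible X) S_finite (fun z _ => SX z)
  X_connected).
Qed.

Definition flat d : set (power X n) :=
  [set x | (forall i j g, link (blocks d) i j g -> act g (x i) = x j) /\
           (forall i s, zcol d i = Some s -> x i = s)].

(** Moves one block of [x] and keeps the rest; the connected space [X] is the parameter space, in
    the role of an interval. *)
Definition slice x (b : coloring G n) (t : X) : power X n :=
  fun i => if b i is Some g then act g t else x i.

Lemma slice_continuous x b : continuous (slice x b).
Proof.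
apply: (@power_tuple_continuous X n (fun i t => if b i is Some g then act g t else x i)).
move=> i; case: (b i) => [g|]; last exact: endomorphism_cst.
by have [_ _] := act_ok.
Qed.

(** * The flat of one element of the Dowling poset *)

Section Member.
Variable d : colored_partition G n X.
Hypothesis dP : dowling_poset d.

Let dpart : is_partial_G_partition (blocks d) := let: And3 p _ _ := dP in p.

Lemma zcol_zero_block i s :
  zcol d i = Some s -> i \in zero_block (blocks d) /\ S s.
Proof.
have [_ dz dnz] := dP; move=> zi; have [iZ|iZ] := boolP (i \in zero_block (blocks d)).
  by have [s' Ss'] := dz i iZ; rewrite zi => -[->].
by have := dnz i iZ; rewrite zi.
Qed.

Lemma notin_zero_block i : i \notin zero_block (blocks d) ->
  exists b, proj_class b \in blocks d /\ b i = Some 1.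
Proof. by move=> /(zero_blockPn dpart)[b [? ? _]]; exists b. Qed.

(** A link joins coordinates of one block, so both move or both stay, and coordinates in the zero
    block never move. *)
Lemma slice_flat x b t : flat d x -> proj_class b \in blocks d -> flat d (slice x b t).
Proof.
move=> [xl xz] bB; split=> [i j g|i s zi]; last first.
  rewrite /slice; case bi: (b i) => [g|]; last exact: xz.
  by have [+ _] := zcol_zero_block zi; rewrite (negPf (zero_block_coloring dpart bB bi)).
move=> lij; have [c [cB ci cj]] := lij; rewrite /slice.
case bi: (b i) => [h|].
  by rewrite (partition_coloring_eq dpart cB bB ci bi) invg1 mul1g coloring_mulrE cj /= actM.
case bj: (b j) => [h|]; last exact: xl.
by move: bi; rewrite (partition_coloring_eq dpart cB bB cj bj) coloring_mulrE ci.
Qed.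

Lemma slice_id x b i : flat d x -> proj_class b \in blocks d -> b i = Some 1 ->
  slice x b (x i) = x.
Proof.
move=> [xl _] bB bi; apply/funext => j; rewrite /slice.
by case bj: (b j) => [g|//]; apply: xl; exists b.
Qed.

Lemma flat_nonempty : flat d !=set0.
Proof.
have [p _] := nonsingular_point.
have [r rP] : {r : {set coloring G n} -> coloring G n &
    forall C, C \in blocks d -> C = proj_class (r C)}.
  apply: (@choice _ _ (fun C b => C \in blocks d -> C = proj_class b)) => C.
  case CB: (C \in blocks d); last by exists [ffun=> None].
  by have [b ->] := dpart.1 C CB; exists b.
(* Each block is filled with the images of the single point [p]. A coordinate without a value of
   [zcol] lies in a block, so the defaults [1] and [p] are not reached. *)
pose x : power X n := fun i => if zcol d i is Some s then s else
  if [pick C in blocks d | r C i != None] is Some C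
  then act (odflt 1 (r C i)) p else p.
have xE C i g : C \in blocks d -> r C i = Some g -> x i = act g p.
  move=> CB rCi; have rCB : proj_class (r C) \in blocks d by rewrite -rP.
  have [_ _ dnz] := dP.
  rewrite /x dnz; last exact: (zero_block_coloring dpart rCB rCi).
  case: pickP => [C' /andP[C'B rC'i]|/(_ C)]; last by rewrite CB rCi.
  suff -> : C' = C by rewrite rCi.
  rewrite (rP C) // (rP C') //.
  by apply: (@partition_same_class _ _ _ dpart _ _ i); rewrite -?rP ?rCi.
exists x; split=> [i j g [b [bB bi bj]]|i s zi]; last by rewrite /x zi.
have /proj_class_eqP[h rE] := rP _ bB.
rewrite (xE _ i h bB) ?rE ?coloring_mulrE ?bi /= ?mul1g //.
by rewrite (xE _ j (g * h) bB) ?rE ?coloring_mulrE ?bj //= actM.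
Qed.

Lemma flat_coord i t : i \notin zero_block (blocks d) ->
  exists2 x, flat d x & x i = t.
Proof.
move=> /notin_zero_block[b [bB bi]]; have [x fx] := flat_nonempty.
exists (slice x b t); first exact: slice_flat.
by rewrite /slice bi act1.
Qed.

Lemma flat_link i j g : i \notin zero_block (blocks d) ->
    j \notin zero_block (blocks d) ->
    (forall x, flat d x -> act g (x i) = x j) ->
  link (blocks d) i j g.
Proof.
move=> iZ jZ gij; have [b [bB bi]] := notin_zero_block iZ.
have [p nSp] := nonsingular_point.
have [x fx xi] := flat_coord p iZ.
(* If [j] lies in the block of [i], its link [h] is compared with [g] at a nonsingular value of
   coordinate [i]. *)
case bj: (b j) => [h|].
  have lij : link (blocks d) i j h by exists b.
  suff -> : g = h by [].
  by apply: (act_free nSp); rewrite -xi gij // (fx.1 _ _ _ lij).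
(* Sliding the block of [i] leaves coordinate [j] fixed, so the injective map [act g] would be
   constant on a space with two points. *)
have [q [r qr]] := X_not_point; exfalso; apply: qr.
have xj t : act g t = x j.
  by rewrite -[t]act1; have := gij _ (slice_flat t fx bB); rewrite /slice bi bj.
by rewrite -(actK g q) -(actK g r) !xj.
Qed.

(** A coordinate outside the zero block takes every value of [X], hence is not constant. *)
Lemma flat_cst i s : (forall x, flat d x -> x i = s) -> zcol d i = Some s.
Proof.
move=> xs; have [iZ|iZ] := boolP (i \in zero_block (blocks d)); last first.
  have [q [r qr]] := X_not_point; exfalso; apply: qr.
  have [x fx <-] := flat_coord q iZ; have [y fy <-] := flat_coord r iZ.
  by rewrite !xs.
have [_ dz _] := dP; have [s' _ zi] := dz i iZ; have [x fx] := flat_nonempty.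
by rewrite zi -(fx.2 _ _ zi) (xs x fx).
Qed.

Lemma flat_connected : connected (flat d).
Proof.
suff comp x y : flat d x -> flat d y -> connected_component (flat d) x y.
  have [x fx] := flat_nonempty.
  suff <- : connected_component (flat d) x = flat d by exact: component_connected.
  by apply/seteqP; split=> [|y fy]; [exact: connected_component_sub|exact: comp].
(* Induction on the number of coordinates at which the two points differ. *)
move=> + fy; have [m] := ubnP #|[set i | `[< x i <> y i >]]%SET|.
elim: m x => // m IHm x ltm fx.
have [xy|/existsNP[i xyi]] := pselect (forall i, x i = y i).
  by rewrite (_ : y = x); [exact: connected_component_refl|apply/funext => i].
have iZ : i \notin zero_block (blocks d).
  apply/negP => iZ; apply: xyi; have [_ dz _] := dP; have [s _ zi] := dz i iZ.
  by rewrite (fx.2 _ _ zi) (fy.2 _ _ zi).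
have [b [bB bi]] := notin_zero_block iZ.
(* The range of the slice is connected and joins [x], at parameter [x i], to a point that agrees
   with [y] on the block of [i] and with [x] elsewhere. *)
have fz := slice_flat (y i) fx bB.
apply: (@connected_component_trans _ _ (slice x b (y i))).
  exists (range (slice x b)); last by exists (y i).
  split; [by exists (x i) => //; exact: slice_id|by move=> _ [t _ <-]; exact: slice_flat|].
  apply: connected_continuous_connected => //.
  by apply: continuous_subspaceT; exact: slice_continuous.
apply: IHm => //; rewrite -ltnS; apply: leq_trans ltm; rewrite ltnS.
apply: proper_card; apply/properP; split.
  apply/fintype.subsetP => j; rewrite !inE => zj xyj; apply: zj.
  rewrite /slice; case bj: (b j) => [g|//].
  by apply: (fy.1); exists b.
exists i; first by rewrite !inE.
by apply/negP; rewrite !inE /slice bi act1.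
Qed.

(** The members of the arrangement that contain the flat intersect exactly in it; being connected,
    it is its own component. *)
Lemma flat_layer : layers n act S (flat d).
Proof.
have [x fx] := flat_nonempty.
pose F := [set H | arrangement act S H /\ flat d `<=` H].
suff FE : \bigcap_(H in F) H = flat d.
  exists F, x; split; first by move=> H [].
    by rewrite FE.
  by rewrite FE connected_component_id //; exact: flat_connected.
apply/seteqP; split=> y; last by move=> fy H [_]; apply.
move=> Fy; split=> [i j g lij|i s zi]; last first.
  apply: (Fy (arr_point i s)); split; last by move=> z [_]; exact.
  by right; exists i, s; split=> //; exact: (zcol_zero_block zi).2.
(* The arrangement only has pairs with [i < j]: a reversed link is inverted, and a loop carries the
   unit of [G]. *)
case: (ltngtP i j) => [ltij|ltji|/val_inj ij].
- apply: (Fy (arr_pair act i j g)); split; last by move=> z [+ _]; exact.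
  by left; exists i, j, g.
- suff <- : act g^-1 (y j) = y i by rewrite actKV.
  apply: (Fy (arr_pair act j i g^-1)); split; last by move=> z [+ _]; apply; exact: link_sym.
  by left; exists j, i, g^-1.
- rewrite -ij in lij *; rewrite (link_fun dpart lij (link_refl lij)).
  exact: act1.
Qed.

End Member.

(** * The bijection with the layers *)

(** The constant coordinates of a flat recover [zcol], hence the zero block; the relations between
    the other coordinates recover the links. *)
Lemma flat_inj d d' : dowling_poset d -> dowling_poset d' -> flat d = flat d' -> d = d'.
Proof.
move=> dP dP' fE; have zE : zcol d = zcol d'.
  apply/funext => i; case zi: (zcol d i) => [s|].
    by apply/esym/(flat_cst dP') => x; rewrite -fE => -[_]; exact.
  case zi': (zcol d' i) => [s|//]; rewrite -zi.
  by apply/(flat_cst dP) => x; rewrite fE => -[_]; exact.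
have [[p dz dnz] [p' dz' dnz']] := (dP, dP').
have Z i : (i \notin zero_block (blocks d)) = (i \notin zero_block (blocks d')).
  apply/idP/idP => iZ; apply/negP => iZ'.
    by have [s _] := dz' i iZ'; rewrite -zE dnz.
  by have [s _] := dz i iZ'; rewrite zE dnz'.
suff bE : blocks d = blocks d' by case: d d' bE zE {dP dP' fE p dz dnz p' dz' dnz' Z}
  => ? ? [? ?] /= -> ->.
apply: eq_partition_link => // i j g; split=> l.
  apply: (flat_link dP'); rewrite -?Z.
  - exact: link_src l.
  - exact: link_dst l.
  - by move=> x; rewrite -fE => -[+ _]; exact.
apply: (flat_link dP); rewrite ?Z.
- exact: link_src l.
- exact: link_dst l.
- by move=> x; rewrite fE => -[+ _]; exact.
Qed.

Lemma layer_is_flat L : layers n act S L -> exists2 d, dowling_poset d & flat d = L.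
Proof.
move=> [F [x [FA Fx ->]]]; set I := \bigcap_(H in F) H in Fx *.
(* Relations are required on all of [I], not merely on the component of [x]. *)
pose rel i j g := forall y, I y -> act g (y i) = y j.
pose Z := [set i | `[< forall y, I y -> S (y i) >]]%SET.
have ZP i : i \in Z <-> forall y, I y -> S (y i) by rewrite inE asboolE.
have rel_sym i j g : rel i j g -> rel j i g^-1.
  by move=> gij y /gij <-; rewrite actK.
have rel_trans i j k g h : rel i j g -> rel j k h -> rel i k (h * g).
  by move=> gij hjk y Iy; rewrite actM gij // hjk.
have rel_Z i j g : rel i j g -> i \in Z -> j \in Z.
  by move=> gij /ZP iZ; apply/ZP => y Iy; rewrite -(gij y Iy); apply/Sing_act/iZ.
have rel_fun i j g h : i \notin Z -> rel i j g -> rel i j h -> g = h.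
  move=> iZ gij hij; have /existsNP[y /not_implyP[Iy nSy]] : ~ forall y, I y -> S (y i).
    by move=> iS; move/negP: iZ; apply; apply/ZP.
  by apply: (act_free nSy); rewrite gij // hij.
(* The colouring of the block of [i], with value 1 at [i]; off [Z] the picked [g] is the only
   candidate. *)
pose col i : coloring G n := [ffun j => [pick g | `[< rel i j g >]]].
have colP i j g : i \notin Z -> col i j = Some g <-> rel i j g.
  move=> iZ; rewrite ffunE; case: pickP => [h /asboolP hij|nrel]; last first.
    by split=> // /asboolP; rewrite nrel.
  by split=> [[<-]//|gij]; rewrite (rel_fun _ _ _ _ iZ hij gij).
have col_self i : i \notin Z -> col i i = Some 1.
  by move=> iZ; apply/colP => // y _; rewrite act1.
have col_class i j g : i \notin Z -> col i j = Some g -> proj_class (col j) = proj_class (col i).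
  move=> iZ /(colP _ _ _ iZ) gij; have jZ : j \notin Z.
    by apply: contra iZ; exact: rel_Z (rel_sym _ _ _ gij).
  apply/proj_class_eqP; exists g; apply/ffunP => k; rewrite coloring_mulrE.
  case cjk: (col j k) => [h|] /=.
    by apply/(colP _ _ _ iZ)/(rel_trans _ _ _ _ _ gij)/colP.
  case cik: (col i k) => [h|//]; move/(colP _ _ _ iZ): cik => hik.
  by have /(colP _ _ _ jZ) := rel_trans _ _ _ _ _ (rel_sym _ _ _ gij) hik; rewrite cjk.
pose beta := [set proj_class (col i) | i in ~: Z]%SET.
have colB i : i \notin Z -> proj_class (col i) \in beta.
  by move=> iZ; apply: imset_f; rewrite finset.in_setC.
have betaP : is_partial_G_partition beta.
  split=> [C /imsetP[i]|C C' /imsetP[i + ->] /imsetP[j + ->]]; rewrite !finset.in_setC.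
    move=> iZ ->; exists (col i) => //; apply/set0Pn; exists i.
    by rewrite inE col_self.
  move=> iZ jZ; apply: contraNT => /pred0Pn[k /=].
  rewrite !block_support_proj_class !mem_color_support => /andP[].
  case cik: (col i k) => [g|//] _; case cjk: (col j k) => [h|//] _.
  by rewrite -(col_class _ _ _ iZ cik) (col_class _ _ _ jZ cjk).
have linkP i j g : link beta i j g <-> i \notin Z /\ rel i j g.
  have link_col : i \notin Z -> link beta i j g <-> rel i j g.
    move=> iZ; rewrite -(colP _ _ _ iZ).
    exact: (link_reprP betaP _ _ (colB i iZ) (col_self i iZ)).
  split=> [lij|[iZ gij]]; last exact/link_col.
  suff iZ : i \notin Z by split=> //; exact/link_col.
  have [b [/imsetP[k + /esym/proj_class_eqP[h bE]] bi _]] := lij.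
  rewrite finset.in_setC => kZ.
  move: bi; rewrite bE coloring_mulrE; case cki: (col k i) => [u|//] _.
  move/(colP _ _ _ kZ): cki => uki; apply: contra kZ; exact: rel_Z (rel_sym _ _ _ uki).
have ZE i : (i \in zero_block beta) = (i \in Z).
  apply: negb_inj; apply/idP/idP; first by move=> /(zero_blockPn betaP)/linkP[].
  by move=> iZ; apply/(zero_blockPn betaP)/linkP; split=> // y _; rewrite act1.
(* The base point [x] supplies the values on the zero block, which single out its component. *)
pose d := ColoredPartition beta (fun i => if i \in Z then Some (x i) else None).
have dP : dowling_poset d.
  split=> //= i; rewrite ZE => iZ; last by rewrite (negPf iZ).
  by exists (x i); [move/ZP: iZ; exact|rewrite iZ].
have fdx : flat d x.
  split=> /= [i j g /linkP[_]|i s]; first exact.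
  by case: ifP => // _ [].
exists d => //; apply/seteqP; split.
  (* The flat is connected and contains [x], so it only has to lie in [I]. *)
  apply: connected_component_max => //; last exact: flat_connected.
  move=> y fy H FH; have IH z : I z -> H z by exact.
  have yZ i : i \in Z -> y i = x i by move=> iZ; apply: fy.2 => /=; rewrite iZ.
  case: (FA H FH) => [[i [j [g [_ HE]]]]|[i [s [Ss HE]]]]; rewrite HE /=.
    have gij : rel i j g by move=> z /IH; rewrite HE.
    (* For [i] in [Z] both coordinates of [y] are those of [x], which satisfies the equation;
       otherwise the equation is a link. *)
    have [iZ|iZ] := boolP (i \in Z); last by apply: fy.1; apply/linkP.
    by rewrite /arr_pair /= !yZ ?gij //; exact: rel_Z gij iZ.
  have is_ z : I z -> z i = s by move/IH; rewrite HE.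
  rewrite /arr_point /= yZ ?is_ //; apply/ZP => z /is_ ->; exact: Ss.
move=> y Cy; have Iy : I y := connected_component_sub Cy.
split=> /= [i j g /linkP[_]|i s]; first exact.
case: ifP => // /ZP iS [<-].
(* This coordinate maps the connected component into the finite set [S], so it is constant there. *)
pose pr (z : power X n) := z i.
apply: (@connected_finite_subsingleton X (pr @` connected_component I x) S).
- exact: points_accessible.
- exact: S_finite.
- by move=> _ [z /connected_component_sub Iz <-]; exact: (iS _ Iz).
- apply: connected_continuous_connected; first exact: component_connected.
  by apply: continuous_subspaceT; exact: power_proj_continuous.
- by exists y.
- by exists x => //; exact: connected_component_refl.
Qed.

(** * Comparison of the two orders *)

(** It suffices that, for a single step, every equation of [d] follows from those of [d']. *)
Lemma flat_antimono d d' : dowling_le act S d d' -> flat d' `<=` flat d.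
Proof.
elim=> {d d'} [d d'|d x|d1 d2 d3 _ f12 _ f23]; [|by []|exact: subset_trans f23 f12].
move=> [dP dP' step] y fy; have [[dpart _ _] [dpart' _ _]] := (dP, dP').
have rename (b c : coloring G n) (u v : 'I_n) g :
    coloring_mulr b g = c -> c u = Some 1 ->
      b u = Some g^-1 /\ forall h, c v = Some h -> b v = Some (h * g^-1).
  move=> <-; rewrite !coloring_mulrE; case: (b u) => //= p [/eqP].
  rewrite -eq_invg_mul => /eqP <-; rewrite invgK; split=> // h.
  by case: (b v) => //= q [<-]; rewrite mulgKV.
case: step => [[beta [a [b [g [ab dE dE' zE]]]]]|[b [f [fS fE dE zE]]]].
  split=> [i j h [c [+ ci cj]]|i s zi]; last by apply: fy.2; rewrite zE.
  have mergedB : proj_class (coloring_union a (coloring_mulr b g)) \in blocks d'.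
    by rewrite dE' !inE eqxx orbT.
  have ij_merged u v : coloring_union a (coloring_mulr b g) i = Some u ->
      coloring_union a (coloring_mulr b g) j = Some v -> h = v * u^-1 -> act h (y i) = y j.
    move=> iu jv ->; apply: fy.1; exact: (link_coloring mergedB iu jv).
  rewrite dE !inE => /orP[cB|/orP[]/eqP/esym/proj_class_eqP[m /esym cE]].
  - by apply: fy.1; exists c; split=> //; rewrite dE' !inE cB.
  - have [ai /(_ _ cj) aj] := rename _ _ _ j _ cE ci.
    apply: (ij_merged m^-1 (h * m^-1)); rewrite ?coloring_unionE ?ai ?aj //.
    by rewrite mulgK.
  - have [bi /(_ _ cj) bj] := rename _ _ _ j _ cE ci.
    (* On the support of [b] the union is [b] times [g], and this factor cancels in quotients of
       colours. *)
    have an k : b k != None -> a k = None.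
      move=> bk; have /pred0P/(_ k) := ab; rewrite /= !inE bk andbT.
      by move/negbFE/eqP.
    apply: (ij_merged (m^-1 * g) (h * m^-1 * g));
      rewrite ?coloring_unionE ?coloring_mulrE ?an ?bi ?bj //=.
    by rewrite invMg invgK !mulgA mulgK mulgKV.
have bB : proj_class b \in blocks d by rewrite dE !inE eqxx orbT.
split=> [i j h [c [+ ci cj]]|i s zi]; last first.
  apply: fy.2; rewrite zE; case bi: (b i) => [u|//].
  by have [+ _] := zcol_zero_block dP zi; rewrite (negPf (zero_block_coloring dpart bB bi)).
rewrite dE !inE => /orP[cB|/eqP/esym/proj_class_eqP[m /esym cE]].
  by apply: fy.1; exists c.
have [bi /(_ _ cj) bj] := rename _ _ _ j _ cE ci.
(* The whole block now has prescribed values, and the equivariance of [f] gives back the old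
   link. *)
have yE k u : b k = Some u -> y k = f u by move=> bk; apply: fy.2; rewrite zE bk.
by rewrite (yE i _ bi) (yE j _ bj) fE.
Qed.

(** On the flat of [d'], fixing coordinate [i] at [s] fixes its whole block in [d], so the block can
    be coloured through the orbit map of [s]. *)
Lemma color_block d d' b i s : dowling_poset d -> dowling_poset d' ->
  flat d' `<=` flat d -> proj_class b \in blocks d -> b i = Some 1 ->
  zcol d' i = Some s ->
  exists2 d1, dowling_step act S d d1 &
    flat d' `<=` flat d1 /\ (#|blocks d1| < #|blocks d|)%N.
Proof.
move=> dP dP' sub bB bi zi'; have [dpart dz dnz] := dP.
have [_ Ss] := zcol_zero_block dP' zi'.
pose d1 := ColoredPartition (blocks d :\ proj_class b)%SET
  (fun k => if b k is Some g then Some (act g s) else zcol d k).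
have part1 : is_partial_G_partition (blocks d1).
  split=> [C|C C']; rewrite !inE; first by move=> /andP[_ /dpart.1].
  by move=> /andP[_ CB] /andP[_ C'B]; apply: dpart.2.
have Z1 k : (k \in zero_block (blocks d1)) = (b k != None) || (k \in zero_block (blocks d)).
  apply/negb_inj; rewrite negb_or negbK; apply/idP/andP.
    move=> /(zero_blockPn part1)[c [/setD1P[cb cB] ck _]]; split.
      case bk: (b k) => [u|//]; case/eqP: cb.
      by apply: (partition_same_class dpart cB bB (i := k)); rewrite ?ck ?bk.
    by apply/(zero_blockPn dpart); exists c.
  move=> [/eqP bk /(zero_blockPn dpart)[c [cB ck _]]]; apply/(zero_blockPn part1).
  exists c; split=> //; apply/setD1P; split=> //; apply/eqP => /proj_class_eqP[m bE].
  by move: bk; rewrite bE coloring_mulrE ck.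
have dP1 : dowling_poset d1.
  split=> // k; rewrite Z1 /=; case bk: (b k) => [u|] //=.
  - by move=> _; exists (act u s) => //; exact: Sing_act.
  - exact: dz.
  - exact: dnz.
exists d1; first split=> //.
  right; exists b, (fun g => act g s); split=> //=.
  - by move=> g; exact: Sing_act.
  - by move=> g h; rewrite actM.
  - by rewrite finset.setUC finset.setD1K.
split; last by rewrite (cardsD1 (proj_class b) (blocks d)) bB.
move=> y fy; have [yl yz] := sub y fy; split=> /= [k l g [c [/setD1P[_ cB] ck cl]]|k t].
  by apply: yl; exists c.
case bk: (b k) => [u|]; last exact: yz.
by move=> [<-]; rewrite -(yl i k u) ?(fy.2 _ _ zi') //; exists b.
Qed.

(** On the flat of [d'] the link expresses both blocks through coordinate [i]: by [a] on the first
    and, since [b] is normalised at [j], by [b] times [g] on the second. *)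
Lemma merge_blocks d d' a b i j g : dowling_poset d -> dowling_poset d' ->
  flat d' `<=` flat d -> proj_class a \in blocks d -> a i = Some 1 -> a j = None ->
  proj_class b \in blocks d -> b j = Some 1 -> link (blocks d') i j g ->
  exists2 d1, dowling_step act S d d1 &
    flat d' `<=` flat d1 /\ (#|blocks d1| < #|blocks d|)%N.
Proof.
move=> dP dP' sub aB ai aj bB bj lij; have [dpart dz dnz] := dP.
have ab : proj_class a != proj_class b.
  by apply/eqP => /proj_class_eqP[m bE]; move: bj; rewrite bE coloring_mulrE aj.
have dis k : a k != None -> b k = None.
  move=> ak; case bk: (b k) => [u|//]; case/eqP: ab.
  by apply: (partition_same_class dpart aB bB (i := k)); rewrite ?bk.
pose e := coloring_union a (coloring_mulr b g).
have eE k : (e k != None) = (a k != None) || (b k != None).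
  by rewrite coloring_unionE coloring_mulrE; case: (a k); case: (b k).
pose beta := (blocks d :\ proj_class a :\ proj_class b)%SET.
have blocksE : blocks d = (beta :|: [set proj_class a; proj_class b])%SET.
  apply/setP => C; rewrite !inE.
  have [->|Cb] := eqVneq C (proj_class b); first by rewrite bB orbT.
  by have [->|Ca] := eqVneq C (proj_class a); rewrite ?aB ?orbF.
pose d1 := ColoredPartition (beta :|: [set proj_class e])%SET (zcol d).
have beta_disjoint c k : proj_class c \in beta -> c k != None -> e k = None.
  move=> /setD1P[cb /setD1P[ca cB]] ck; apply/eqP; rewrite -[_ == _]negbK eE.
  apply/norP; split; apply/negP => xk.
    by case/eqP: ca; exact: (partition_same_class dpart cB aB ck xk).
  by case/eqP: cb; exact: (partition_same_class dpart cB bB ck xk).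
have betaE C : C \in beta -> exists2 c, C = proj_class c & color_support c != finset.set0.
  by move=> /setD1P[_ /setD1P[_ /dpart.1]].
have part1 : is_partial_G_partition (blocks d1).
  split=> [C|C C']; rewrite /= !inE.
    move=> /orP[|/eqP ->]; first by have := betaE C; rewrite !inE.
    by exists e => //; apply/set0Pn; exists i; rewrite inE eE ai.
  have e_disjoint D : D \in beta ->
      [disjoint block_support D & block_support (proj_class e)]%bool.
    move=> DB; have [c Dc _] := betaE D DB; rewrite Dc in DB *.
    apply/pred0P => k /=; rewrite !block_support_proj_class !mem_color_support.
    by case ck: (c k) => [u|//]; rewrite (beta_disjoint c k DB) ?ck.
  have betaI D : [&& D != proj_class b, D != proj_class a & D \in blocks d] -> D \in beta.
    by rewrite !inE.
  move=> /orP[/betaI CB|/eqP->] /orP[/betaI C'B|/eqP->]; last by rewrite eqxx.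
  - by apply: dpart.2; [case/setD1P: CB => _ /setD1P[]|case/setD1P: C'B => _ /setD1P[]].
  - by move=> _; exact: e_disjoint.
  - by move=> _; rewrite disjoint_sym; exact: e_disjoint.
have Z1 k : (k \in zero_block (blocks d1)) = (k \in zero_block (blocks d)).
  apply: negb_inj; apply/idP/idP.
    move=> /(zero_blockPn part1)[c [/setUP[/setD1P[_ /setD1P[_ cB]]|
      /set1P/esym/proj_class_eqP[m cE]] ck _]].
      exact: (zero_block_coloring dpart cB ck).
    have : e k != None by move: ck; rewrite cE coloring_mulrE; case: (e k).
    rewrite eE => /orP[]; case xk: (_ k) => [u|//] _.
      exact: (zero_block_coloring dpart aB xk).
    exact: (zero_block_coloring dpart bB xk).
  move=> /(zero_blockPn dpart)[c [+ ck _]]; rewrite blocksE => /setUP[cB|].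
    by apply: (zero_block_coloring part1 (b := c) _ ck); rewrite !inE in cB *; rewrite cB.
  move=> cab; have : e k != None.
    rewrite eE; move: cab ck => /set2P[] /esym/proj_class_eqP[m ->]; rewrite coloring_mulrE.
      by case: (a k).
    by case: (b k) => // u _; rewrite orbT.
  case ek: (e k) => [u|//] _.
  by apply: (zero_block_coloring part1 (b := e) _ ek); rewrite !inE eqxx orbT.
have dP1 : dowling_poset d1.
  by split=> // k; rewrite Z1 /=; [exact: dz|exact: dnz].
exists d1; first split=> //.
  left; exists beta, a, b, g; split=> //; apply/pred0P => k /=.
  by rewrite !mem_color_support; case ak: (a k) => [u|//]; rewrite dis ?ak.
split; last first.
  have bB' : proj_class b \in (blocks d :\ proj_class a)%SET by rewrite !inE eq_sym ab.
  (* Two classes are removed and at most one is added. *)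
  rewrite (cardsD1 (proj_class a) (blocks d)) aB (cardsD1 (proj_class b) (_ :\ _)) bB' /=.
  by apply: leq_ltn_trans (leq_card_setU _ _) _; rewrite cards1 addn1 add1n.
move=> y fy; have [yl yz] := sub y fy; split=> //= k l h [c [+ ck cl]].
move=> /setUP[/setD1P[_ /setD1P[_ cB]]|/set1P ce].
  by apply: yl; exists c.
have ye m u : e m = Some u -> y m = act u (y i).
  rewrite coloring_unionE coloring_mulrE; case am: (a m) => [v|].
    by move=> [<-]; apply/esym/yl; exists a.
  case bm: (b m) => [v|//] [<-]; rewrite actM (fy.1 _ _ _ lij).
  by apply/esym/yl; exists b.
have /esym/proj_class_eqP[m cE] := ce.
move: ck cl; rewrite cE !coloring_mulrE.
case ek: (e k) => [u|//] [um]; case el: (e l) => [v|//] [<-].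
have <- : u^-1 = m by apply/eqP; rewrite eq_invg_mul um.
by rewrite (ye _ _ ek) (ye _ _ el) -actM mulgKV.
Qed.

Lemma flat_le d d' : dowling_poset d -> dowling_poset d' ->
  flat d' `<=` flat d -> dowling_le act S d d'.
Proof.
move=> + dP'; have [m] := ubnP #|blocks d|; elim: m d => // m IHm d ltm dP sub.
(* Either the flats coincide, or one step leads from [d] towards [d'] and lowers the number of
   blocks. *)
suff : flat d `<=` flat d' \/ exists2 d1, dowling_step act S d d1 &
    flat d' `<=` flat d1 /\ (#|blocks d1| < #|blocks d|)%N.
  case=> [sub'|[d1 step [sub1 lt1]]].
    have -> : d = d' by apply: flat_inj => //; apply/seteqP.
    exact: rt_refl.
  apply: rt_trans (rt_step _ _ _ _ step) _; apply: IHm => //; last by case: step.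
  exact: leq_trans lt1 _.
have [dpart dz dnz] := dP; have [dpart' dz' dnz'] := dP'.
have zsub i s : zcol d i = Some s -> zcol d' i = Some s.
  by move=> zi; apply: (flat_cst dP') => x /sub fx; exact: fx.2.
have [|/existsNP[x /not_implyP[fx nfx]]] := pselect (forall x, flat d x -> flat d' x).
  by left.
right; case/not_andP: nfx => [/existsNP[i /existsNP[j /existsNP[g /not_implyP[lij]]]]|
  /existsNP[i /existsNP[s /not_implyP[zi' xis]]]].
  move=> gij; have outZ k : k \notin zero_block (blocks d') -> k \notin zero_block (blocks d).
    by move=> kZ'; apply/negP => /dz[s _ /zsub]; rewrite dnz'.
  have [a [aB ai]] := notin_zero_block dP (outZ _ (link_src dpart' lij)).
  have [b [bB bj]] := notin_zero_block dP (outZ _ (link_dst dpart' lij)).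
  (* If [i] and [j] share a block of [d], a point of the flat of [d'] with nonsingular coordinate
     [i] forces [g = h], and the equation cannot fail at [x]. *)
  case aj: (a j) => [h|]; last exact: (merge_blocks dP dP' sub aB ai aj bB bj lij).
  exfalso; apply: gij; have lij' : link (blocks d) i j h by exists a.
  suff -> : g = h by exact: fx.1.
  have [p nSp] := nonsingular_point.
  have [y fy yi] := flat_coord dP' p (link_src dpart' lij).
  apply: (act_free nSp); rewrite -yi (fy.1 _ _ _ lij).
  by apply/esym; exact: (sub y fy).1.
(* In the zero block of [d] the coordinate would already have the value [s]. *)
have iZ : i \notin zero_block (blocks d).
  apply/negP => /dz[t _ zi]; apply: xis; rewrite (fx.2 _ _ zi).
  by have := zsub _ _ zi; rewrite zi' => -[].
have [b [bB bi]] := notin_zero_block dP iZ.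
exact: (color_block dP dP' sub bB bi zi').
Qed.

(** * Equivariance under the wreath product *)

Section Wreath.
Variable w : wreath G n.

(** Coordinate [i] of [wreath_power act w x] is [act (twist i) (x (pre i))]. *)
Let pre i : 'I_n := w.2^-1 i.
Let twist i : G := w.1 (pre i).

Lemma wreath_coloringE b i :
  wreath_coloring w b i = omap (mulg (twist i)) (b (pre i)).
Proof. by rewrite ffunE. Qed.

(** Left multiplication by the twists commutes with the right multiplication that defines projective
    classes. *)
Lemma wreath_proj_class b :
  [set wreath_coloring w c | c in proj_class b]%SET = proj_class (wreath_coloring w b).
Proof.
have comm g : wreath_coloring w (coloring_mulr b g) = coloring_mulr (wreath_coloring w b) g.
  apply/ffunP => i; rewrite wreath_coloringE !coloring_mulrE wreath_coloringE.
  by case: (b _) => //= u; rewrite mulgA.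
apply/setP => c; apply/imsetP/proj_classP => [[_ /proj_classP[g ->] ->]|[g ->]].
  by exists g.
by exists (coloring_mulr b g) => //; apply/proj_classP; exists g.
Qed.

Section Partition.
Variable d : colored_partition G n X.
Hypothesis dP : dowling_poset d.

Let dpart : is_partial_G_partition (blocks d) := let: And3 p _ _ := dP in p.

Lemma wreath_blocks C : C \in blocks (wreath_partition act w d) ->
  exists2 b, proj_class b \in blocks d & C = proj_class (wreath_coloring w b).
Proof.
move=> /imsetP[D DB ->]; have [b [i [DE bB _]]] := partition_classP dpart DB.
by exists b => //; rewrite DE wreath_proj_class.
Qed.

Lemma wreath_mem_blocks b : proj_class b \in blocks d ->
  proj_class (wreath_coloring w b) \in blocks (wreath_partition act w d).
Proof. by move=> bB; apply/imsetP; exists (proj_class b); rewrite ?wreath_proj_class. Qed.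

(** The group element on the right comes from writing the relation for [g] at a transformed tuple
    and solving for the coordinate at [pre j]. *)
Lemma wreath_link i j g : link (blocks (wreath_partition act w d)) i j g <->
  link (blocks d) (pre i) (pre j) ((twist j)^-1 * g * twist i).
Proof.
split=> [[c [/wreath_blocks[b bB /esym/proj_class_eqP[m ->]]]]|[b [bB bi bj]]].
  rewrite !coloring_mulrE !wreath_coloringE.
  case bi: (b (pre i)) => [p|//] [ip]; case bj: (b (pre j)) => [q|//] [<-].
  suff -> : (twist j)^-1 * (twist j * q * m) * twist i = q * p^-1.
    exact: (link_coloring bB bi bj).
  have /eqP := ip; rewrite -mulgA -eq_invg_mul => /eqP tE.
  by rewrite -!mulgA mulKg -[twist i]invgK tE invMg mulKVg.
rewrite -[g](mulgK (twist i)) -[g * _](mulKVg (twist j)) [_^-1 * _]mulgA.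
by apply: (link_coloring (wreath_mem_blocks bB)); rewrite wreath_coloringE ?bi ?bj //= mulg1.
Qed.

Lemma wreath_dowling : dowling_poset (wreath_partition act w d).
Proof.
have [_ dz dnz] := dP.
have part : is_partial_G_partition (blocks (wreath_partition act w d)).
  split=> [C /wreath_blocks[b bB ->]|C C' /wreath_blocks[b bB ->] /wreath_blocks[c cB ->]].
    exists (wreath_coloring w b) => //.
    have [a [i [bE aB ai]]] := partition_classP dpart bB.
    apply/set0Pn; exists (w.2 i); rewrite inE wreath_coloringE /pre permK.
    by have /esym/proj_class_eqP[m ->] := bE; rewrite coloring_mulrE ai.
  apply: contraNT => /pred0Pn[i]; rewrite /= !block_support_proj_class !mem_color_support.
  rewrite !wreath_coloringE => /andP[bi ci].
  rewrite -!wreath_proj_class (partition_same_class dpart bB cB (i := pre i)) //.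
    by case: (b _) bi.
  by case: (c _) ci.
have Z i : (i \in zero_block (blocks (wreath_partition act w d))) =
    (pre i \in zero_block (blocks d)).
  apply: negb_inj; apply/idP/idP.
    by move=> /(zero_blockPn part)/wreath_link/(link_src dpart).
  move=> /(zero_blockPn dpart) l; apply/(zero_blockPn part)/wreath_link.
  by rewrite mulg1 mulVg.
split=> // i; rewrite Z => iZ /=.
  have [s Ss zi] := dz _ iZ; exists (act (twist i) s); first exact: Sing_act.
  by rewrite -/(pre i) zi.
by rewrite -/(pre i) dnz.
Qed.

Lemma wreath_flat : wreath_power act w @` flat d = flat (wreath_partition act w d).
Proof.
apply/seteqP; split=> [_ [x [xl xz] <-]|y [yl yz]].
  split=> [i j g /wreath_link/xl|i s /=].
    rewrite /wreath_power -/(pre i) -/(pre j) -/(twist i) -/(twist j) => <-.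
    by rewrite -!actM -mulgA mulKVg.
  rewrite /wreath_power -/(pre i) -/(twist i); case zi: (zcol d (pre i)) => [t|//] [<-].
  by rewrite (xz _ _ zi).
(* The image of [y] under the inverse of [w]. *)
pose x : power X n := fun j => act (w.1 j)^-1 (y (w.2 j)).
have preK j : pre (w.2 j) = j by rewrite /pre permK.
exists x; last first.
  by apply/funext => i; rewrite /wreath_power /x actKV permKV.
split=> [i j g lij|i s zi].
  have /yl : link (blocks (wreath_partition act w d)) (w.2 i) (w.2 j)
      (w.1 j * g * (w.1 i)^-1).
    by apply/wreath_link; rewrite /twist !preK -!mulgA mulVg mulg1 mulKg.
  by rewrite /x => <-; rewrite !actM actK.
have /yz : zcol (wreath_partition act w d) (w.2 i) = Some (act (w.1 i) s).
  by rewrite /= permK zi.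
by rewrite /x => ->; rewrite actK.
Qed.

End Partition.

End Wreath.

End Flats.

Theorem theorem3p6 (G : finGroupType) (X : spaceType) (act : G -> X -> X) (n : nat)
    (act_ok : is_left_action act)
    (X_connected : connected [set: X])
    (X_not_point : exists x y : X, x <> y)
    (S_finite : finite_set (Sing act)) :
  exists phi : set (power X n) -> colored_partition G n X,
    [/\ set_bij (layers n act (Sing act)) (dowling n (Sing act)) phi,
        forall L M, layers n act (Sing act) L -> layers n act (Sing act) M ->
          (layer_le L M <-> dowling_le act (Sing act) (phi L) (phi M)) &
        forall (w : wreath G n) L, layers n act (Sing act) L ->
          layers n act (Sing act) (wreath_power act w @` L) /\
          phi (wreath_power act w @` L) = wreath_partition act w (phi L)].
Proof.
(* [phi] is a chosen inverse of [flat] on the layers, with a default value on other sets. *)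
have [phi phiP] : {phi : set (power X n) -> colored_partition G n X & forall L,
    layers n act (Sing act) L -> dowling n (Sing act) (phi L) /\ flat act (phi L) = L}.
  apply: (@choice _ _ (fun L d => layers n act (Sing act) L ->
    dowling n (Sing act) d /\ flat act d = L)) => L.
  have [LL|nLL] := pselect (layers n act (Sing act) L).
    by have [d dP dL] := layer_is_flat act_ok X_connected X_not_point S_finite LL; exists d.
  by exists (ColoredPartition finset.set0 (fun=> None)).
have flatL d : dowling n (Sing act) d -> layers n act (Sing act) (flat act d).
  exact: flat_layer.
have flatK d : dowling n (Sing act) d -> phi (flat act d) = d.
  move=> dP; have [phidP] := phiP _ (flatL d dP).
  exact: (flat_inj act_ok X_connected X_not_point S_finite).
exists phi; split.
- split=> [L /phiP[]//|L M /set_mem/phiP[_ phiL] /set_mem/phiP[_ phiM] LM|d dP].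
    by rewrite -phiL -phiM LM.
  by exists (flat act d); [exact: flatL|exact: flatK].
- move=> L M /phiP[dL phiL] /phiP[dM phiM]; rewrite /layer_le -{1}phiL -{1}phiM.
  by split; [exact: flat_le|exact: flat_antimono].
- move=> w L /phiP[dL phiL].
  have wdP := wreath_dowling act_ok w dL.
  (* With [L] written as the flat of [phi L], its image is again a flat, on which [phi] inverts
     [flat]. *)
  rewrite -{1 2}phiL wreath_flat //.
  by split; [exact: flatL|exact: flatK].
Qed.
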